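(* Let $\mathcal{G}:\mathbb{R}^N\to\mathbb{R}^M$ be the phaseless far-field observation map, let $\Sigma_\eta\in\mathbb{R}^{M\times M}$ be the noise covariance matrix, and write $|v|_{\Sigma_\eta}=|\Sigma_\eta^{-1/2}v|$ for $v\in\mathbb{R}^M$. Suppose that $\mathcal{G}$ satisfies: (i) for every $\varepsilon>0$ there is $\hat M=\hat M(\varepsilon)\in\mathbb{R}$ such that for all $\mathbf{Z}\in\mathbb{R}^N$, $$|\mathcal{G}(\mathbf{Z})|_{\Sigma_\eta}\le e^{\varepsilon\|\mathbf{Z}\|_2^2+\hat M};$$ (ii) for every $r>0$ there is $K=K(r)>0$ such that for all $\mathbf{Z}_1,\mathbf{Z}_2\in\mathbb{R}^N$ with $\max\{\|\mathbf{Z}_1\|_2,\|\mathbf{Z}_2\|_2\}<r$, $$|\mathcal{G}(\mathbf{Z}_1)-\mathcal{G}(\mathbf{Z}_2)|_{\Sigma_\eta}\le K\|\mathbf{Z}_1-\mathbf{Z}_2\|_2.$$ Suppose also that the prior measure $\mu_{pr}$ on $\mathbb{R}^N$ satisfies $\mu_{pr}(\mathbb{R}^N)=1$. Then, for data $\mathbf{Y}\in\mathbb{R}^M$, the posterior measure $\mu_{post}$ is a well-defined probability measure on $\mathbb{R}^N$ and is absolutely continuous with respect to $\mu_{pr}$. Moreover, the posterior measure is Lipschitz in the data with respect to the Hellinger distance: for every $r>0$ there exists $C=C(r)>0$ such that, if $\mu_{post}^1$ and $\mu_{post}^2$ are the posterior measures corresponding to data $\mathbf{Y}_1$ and $\mathbf{Y}_2$,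 then $$d_{\mathrm{Hell}}(\mu_{post}^1,\mu_{post}^2)\le C\,\|\mathbf{Y}_1-\mathbf{Y}_2\|_2$$ for all $\mathbf{Y}_1,\mathbf{Y}_2\in\mathbb{R}^M$ with $\max\{\|\mathbf{Y}_1\|_2,\|\mathbf{Y}_2\|_2\}<r$.
   Context: $\|\cdot\|_2$ is the Euclidean norm. The matrix $\Sigma_\eta\in\mathbb{R}^{M\times M}$ is self-adjoint and positive (definite). Forward map. A sound-soft obstacle or crack $D=D(\mathbf{Z})\subset\mathbb{R}^2$ is described by a parameter vector $\mathbf{Z}\in\mathbb{R}^N$. Fix a wavenumber $k>0$ and an incident field $u^{in}(x)=e^{ikx\cdot\mathbf{d}_0}+e^{ikx\cdot\mathbf{d}_\ell}$ with unit vectors $\mathbf{d}_0,\mathbf{d}_\ell\in\mathbb{S}=\{x\in\mathbb{R}^2:|x|=1\}$. The scattered field $u^{sc}$ solves $\Delta u^{sc}+k^2u^{sc}=0$ in $\mathbb{R}^2\setminus\bar D$, $u^{sc}=-u^{in}$ on $\partial D$, and satisfies the Sommerfeld radiation condition $\lim_{r\to\infty}\sqrt r\,(\partial_r u^{sc}-iku^{sc})=0$, $r=|x|$, uniformly in all directions. Its far-field pattern $u^\infty:\mathbb{S}\to\mathbb{C}$ is defined by $u^{sc}(x)=\frac{e^{ik|x|}}{\sqrt{|x|}}\{u^\infty(\hat{\mathbf{x}})+\mathcal{O}(|x|^{-1/2})\}$ as $|x|\to\infty$, where $\hat{\mathbf{x}}=x/|x|$. For fixed observation directions $\hat{\mathbf{x}}_1,\dots,\hat{\mathbf{x}}_M\in\mathbb{S}$,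 the map $\mathcal{G}$ is $\mathcal{G}(\mathbf{Z})=(|u^\infty(\hat{\mathbf{x}}_1)|,\dots,|u^\infty(\hat{\mathbf{x}}_M)|)^\top$, with $u^\infty$ the far-field pattern for $D(\mathbf{Z})$. Bayesian model. Data are modelled as $\mathbf{Y}=\mathcal{G}(\mathbf{Z})+\eta$ with $\eta\sim\mathcal{N}(\mathbf{0},\Sigma_\eta)$. The misfit function is $\Phi(\mathbf{Z};\mathbf{Y})=\frac12|\mathbf{Y}-\mathcal{G}(\mathbf{Z})|_{\Sigma_\eta}^2$. The posterior measure $\mu_{post}$ corresponding to data $\mathbf{Y}$ is defined by the Radon–Nikodym derivative $\frac{d\mu_{post}}{d\mu_{pr}}(\mathbf{Z})\propto e^{-\Phi(\mathbf{Z};\mathbf{Y})}$, i.e. it is normalized to have total mass one. Hellinger distance. For measures $\mu_1,\mu_2$ absolutely continuous with respect to $\mu_0$, $$d_{\mathrm{Hell}}(\mu_1,\mu_2)=\sqrt{\frac12\int\Big(\sqrt{\tfrac{d\mu_1}{d\mu_0}}-\sqrt{\tfrac{d\mu_2}{d\mu_0}}\Big)^2d\mu_0}.$$ One may take $\mu_0=\mu_{pr}$ here. *)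

(* Defs.v *)
From HB Require Import structures.
From mathcomp Require Import all_boot all_order all_algebra.
From mathcomp Require Import all_classical all_reals all_analysis.
From mathcomp Require Import complex.

Set Implicit Arguments.
Unset Strict Implicit.
Unset Printing Implicit Defensive.

Import Order.TTheory GRing.Theory Num.Theory.
Import numFieldNormedType.Exports.

Local Open Scope classical_set_scope.
Local Open Scope ring_scope.
Local Open Scope charge_scope.

(* The norm instance of MathComp-Analysis on matrices is the sup norm; it
   induces the usual topology, but metric statements need the Euclidean norm. *)
Definition norm2 (R : realType) (n : nat) (v : 'cV[R]_n) : R :=
  Num.sqrt (\sum_i v i 0 ^+ 2).

(* R^n with its Borel sigma-algebra. *)
Notation borelRn R n := (g_sigma_algebraType (@open 'cV[R]_n)).

Definition posdefmx (R : realType) (n : nat) (S : 'M[R]_n) : Prop :=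
  S^T = S /\ forall v : 'cV[R]_n, v != 0 -> 0 < (v^T *m S *m v) 0 0.

(* S^(-1/2): for S positive definite, the set below is a singleton. *)
Definition inv_sqrtmx (R : realType) (n : nat) (S : 'M[R]_n) : 'M[R]_n :=
  xget 0 [set B | posdefmx B /\ B *m B = invmx S].

Definition cov_norm (R : realType) (n : nat) (S : 'M[R]_n) (v : 'cV[R]_n) : R :=
  norm2 (inv_sqrtmx S *m v).

Notation plane R := 'cV[R]_2.

Definition cabs (R : realType) (z : R[i]) : R := ComplexField.Normc.normc z.

Definition cis (R : realType) (t : R) : R[i] := Complex (cos t) (sin t).

Definition dot (R : realType) (x y : plane R) : R := \sum_i x i 0 * y i 0.

Definition cderive (R : realType) (v : plane R) (u : plane R -> R[i])
    (x : plane R) : R[i] :=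
  Complex ('D_v (fun y => complex.Re (u y)) x)
          ('D_v (fun y => complex.Im (u y)) x).

Definition unit_vec (R : realType) (i : 'I_2) : plane R := delta_mx i 0.

Definition laplacian (R : realType) (u : plane R -> R[i]) (x : plane R) : R[i] :=
  \sum_i cderive (unit_vec R i) (cderive (unit_vec R i) u) x.

(* On an open set A, existence and continuity of all second partials implies
   that f and its first partials are continuous as well. *)
Definition C2_on (R : realType) (A : set (plane R)) (f : plane R -> R) : Prop :=
  forall (x : plane R) (i j : 'I_2), A x ->
  [/\ derivable f x (unit_vec R i),
      derivable ('D_(unit_vec R i) f) x (unit_vec R j) &
      {for x, continuous ('D_(unit_vec R j) ('D_(unit_vec R i) f))}].

Definition obstacle (R : realType) (D : set (plane R)) : Prop :=
  [/\ D !=set0, open D, bounded_set D & connected (~` closure D)].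

Definition crack (R : realType) (D : set (plane R)) : Prop :=
  exists gamma : R -> plane R,
    [/\ {within `[0, 1]%classic, continuous gamma},
        {in `[0, 1]%classic &, injective gamma} &
        D = gamma @` `[0, 1]%classic].

Definition incident (R : realType) (k : R) (d0 dl x : plane R) : R[i] :=
  cis (k * dot x d0) + cis (k * dot x dl).

(* Classical solution in the complement of closure D; the boundary values are
   limits from the complement (for a crack, hence, from both sides). *)
Definition scattered_field (R : realType) (k : R) (d0 dl : plane R)
    (D : set (plane R)) (u : plane R -> R[i]) : Prop :=
  [/\ C2_on (~` closure D) (fun x => complex.Re (u x)),
      C2_on (~` closure D) (fun x => complex.Im (u x)),
      (forall x, (~` closure D) x ->
         laplacian u x + real_complex R (k ^+ 2) * u x = 0),
      (forall x0, (closure D `\` D°) x0 ->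
         cabs (u x + incident k d0 dl x0)
           @[x --> within (~` closure D) (nbhs x0)] --> (0 : R)) &
      (forall e : R, 0 < e -> exists r0 : R, forall x, r0 <= norm2 x ->
         Num.sqrt (norm2 x) *
           cabs (cderive ((norm2 x)^-1 *: x) u x - Complex 0 k * u x) <= e)].

(* Only the values of uinf on the unit circle matter. *)
Definition far_field_pattern (R : realType) (k : R)
    (u uinf : plane R -> R[i]) : Prop :=
  exists rho : plane R -> R[i],
    (exists C r0 : R, forall x, r0 <= norm2 x ->
       cabs (rho x) <= C * (Num.sqrt (norm2 x))^-1) /\
    (exists r0 : R, forall x, r0 <= norm2 x ->
       u x = cis (k * norm2 x) * real_complex R (Num.sqrt (norm2 x))^-1 *
             (uinf ((norm2 x)^-1 *: x) + rho x)).

Definition phaseless_far_field_map (R : realType) (N M : nat) (k : R)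
    (d0 dl : plane R) (xhat : 'I_M -> plane R)
    (D : 'cV[R]_N -> set (plane R)) (G : 'cV[R]_N -> 'cV[R]_M) : Prop :=
  forall Z, exists u uinf : plane R -> R[i],
    [/\ scattered_field k d0 dl (D Z) u,
        far_field_pattern k u uinf &
        forall m, G Z m 0 = cabs (uinf (xhat m))].

Definition misfit (R : realType) (N M : nat) (Sigma : 'M[R]_M)
    (G : 'cV[R]_N -> 'cV[R]_M) (Y : 'cV[R]_M) (Z : 'cV[R]_N) : R :=
  2^-1 * cov_norm Sigma (Y - G Z) ^+ 2.

(* Normalization is carried by the type of mu.  The library's derivative is
   constantly -oo when mu is not dominated by mu_pr, so the a.e. equation
   cannot hold for such a mu. *)
Definition is_posterior (R : realType) (d : measure_display)
    (T : measurableType d) (mu_pr : probability T R) (Phi : T -> R)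
    (mu : probability T R) : Prop :=
  exists c : R, 0 < c /\
    {ae mu_pr, forall Z, ('d (charge_of_finite_measure mu) '/d mu_pr) Z =
                         (c * expR (- Phi Z))%:E}.

(* Extended-real valued, so that a divergent integral is not read as 0. *)
Definition hellinger (R : realType) (d : measure_display)
    (T : measurableType d) (mu0 : {sigma_finite_measure set T -> \bar R})
    (mu1 mu2 : {finite_measure set T -> \bar R}) : \bar R :=
  sqrte ((2^-1)%:E * \int[mu0]_x
    ((Num.sqrt (fine (('d (charge_of_finite_measure mu1) '/d mu0) x)) -
      Num.sqrt (fine (('d (charge_of_finite_measure mu2) '/d mu0) x)))
     ^+ 2)%:E)%E.

(* Main.v *)
Require Import Defs.
From HB Require Import structures.
From mathcomp Require Import all_boot all_order all_algebra.
From mathcomp Require Import all_classical all_reals all_analysis.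
From mathcomp Require Import measurable_realfun complex.
From mathcomp Require Import ring lra.

Set Implicit Arguments.
Unset Strict Implicit.
Unset Printing Implicit Defensive.

Import Order.TTheory GRing.Theory Num.Theory.
Import numFieldNormedType.Exports.

Local Open Scope classical_set_scope.
Local Open Scope ring_scope.

(** The posterior is the probability with density exp (- Phi) / Lambda relative
to the prior, where Lambda = \int exp (- Phi) is the evidence.  This makes sense
because Phi is measurable and nonnegative, so that 0 < Lambda <= 1; measurability
comes from the local Lipschitz bound on G, which makes Phi continuous.
Uniqueness and absolute continuity are read off the density formula, because
total mass one forces the constant to be 1 / Lambda ([posterior_densityE]).

For the Hellinger estimate write g_i = exp (- Phi_i / 2) for two data vectors
Y_i, so that the square root of the i-th density is g_i / sqrt Lambda_i.  With
a_i = |Y_i - G Z|_Sigma one has g_i = exp (- a_i ^ 2 / 4), and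
a |-> exp (- a ^ 2 / 4) is globally 1-Lipschitz ([expR_gauss_lipschitz]).  Hence
|g_1 - g_2| <= |Y_1 - Y_2|_Sigma <= L |Y_1 - Y_2| =: del uniformly in Z, however
large G Z is.  Integrating g_i ^ 2 gives |Lambda_1 - Lambda_2| <= 2 del.  If
moreover 1 / Lambda_i <= K, elementary algebra ([normalized_lipschitz]) bounds
the difference of the square roots of the densities pointwise by K (1 + K) del,
and since the prior has mass one this also bounds the Hellinger distance
([hellinger_posterior_le]).

It remains to bound Lambda below uniformly over |Y| < r.  The inequality
(y + g) ^ 2 <= 2 y ^ 2 + 2 g ^ 2 gives
Phi (Z; Y) <= |G Z|_Sigma ^ 2 + |Y|_Sigma ^ 2, so Lambda is at least
exp (- (L r) ^ 2) times \int exp (- |G Z|_Sigma ^ 2), and the latter integral is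
positive and independent of Y ([misfit_le], [evidence_le_scale]).

The norm |.|_Sigma is the Euclidean norm of the image under a fixed matrix,
hence a seminorm dominated by the Euclidean norm: this is the constant L. *)

(** * The Euclidean norm *)

Lemma sum_sqr_ge0 (R : realType) n (u : 'cV[R]_n) : 0 <= \sum_i u i 0 ^+ 2.
Proof. by apply: sumr_ge0 => i _; exact: sqr_ge0. Qed.

Lemma norm2_ge0 (R : realType) n (u : 'cV[R]_n) : 0 <= norm2 u.
Proof. exact: sqrtr_ge0. Qed.

Lemma norm2_sqr (R : realType) n (u : 'cV[R]_n) :
  norm2 u ^+ 2 = \sum_i u i 0 ^+ 2.
Proof. by rewrite sqr_sqrtr // sum_sqr_ge0. Qed.

Lemma norm2N (R : realType) n (u : 'cV[R]_n) : norm2 (- u) = norm2 u.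
Proof. by congr Num.sqrt; apply: eq_bigr => i _; rewrite mxE sqrrN. Qed.

Lemma norm2_distC (R : realType) n (u v : 'cV[R]_n) :
  norm2 (u - v) = norm2 (v - u).
Proof. by rewrite -norm2N opprB. Qed.

Lemma norm2_cauchy_schwarz (R : realType) n (u v : 'cV[R]_n) :
  \sum_i u i 0 * v i 0 <= norm2 u * norm2 v.
Proof.
have [v0|v0] := eqVneq (norm2 v) 0.
  have v00 i : v i 0 = 0.
    apply/eqP; rewrite -sqrf_eq0; apply/eqP.
    have := norm2_sqr v; rewrite v0 expr0n /= => /esym/eqP.
    rewrite psumr_eq0; last by move=> j _; exact: sqr_ge0.
    by move=> /allP/(_ i); rewrite mem_index_enum => /(_ isT) /eqP.
  by rewrite v0 mulr0 big1 // => i _; rewrite v00 mulr0.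
(* Expand 0 <= \sum_i (|v|^2 u_i - <u, v> v_i)^2. *)
set s := \sum_i _; have v_gt0 : 0 < norm2 v by rewrite lt_def v0 norm2_ge0.
have : 0 <= norm2 v ^+ 2 * (norm2 v ^+ 2 * norm2 u ^+ 2 - s ^+ 2).
  have -> : norm2 v ^+ 2 * (norm2 v ^+ 2 * norm2 u ^+ 2 - s ^+ 2) =
            \sum_i (norm2 v ^+ 2 * u i 0 - s * v i 0) ^+ 2.
    transitivity (\sum_i ((norm2 v ^+ 2) ^+ 2 * u i 0 ^+ 2
       - 2 * norm2 v ^+ 2 * s * (u i 0 * v i 0) + s ^+ 2 * v i 0 ^+ 2)).
      rewrite big_split /= sumrB -!mulr_sumr -/s -!norm2_sqr; ring.
    by apply: eq_bigr => i _; ring.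
  by apply: sumr_ge0 => i _; exact: sqr_ge0.
rewrite pmulr_rge0 ?exprn_gt0 // subr_ge0 -exprMn => h.
rewrite (le_trans (ler_norm s)) // -(@ler_pXn2r _ 2) ?nnegrE //.
  by rewrite real_normK ?num_real // [norm2 u * _]mulrC.
by rewrite mulr_ge0 ?norm2_ge0.
Qed.

Lemma ler_norm2D (R : realType) n (u v : 'cV[R]_n) :
  norm2 (u + v) <= norm2 u + norm2 v.
Proof.
rewrite -(@ler_pXn2r _ 2) ?nnegrE ?addr_ge0 ?norm2_ge0 //.
have -> : norm2 (u + v) ^+ 2 =
    norm2 u ^+ 2 + 2 * (\sum_i u i 0 * v i 0) + norm2 v ^+ 2.
  rewrite !norm2_sqr mulr_sumr -!big_split /=; apply: eq_bigr => i _.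
  by rewrite mxE; ring.
by have := norm2_cauchy_schwarz u v; nra.
Qed.

Lemma ler_dist_norm2 (R : realType) n (u v : 'cV[R]_n) :
  `|norm2 u - norm2 v| <= norm2 (u - v).
Proof.
rewrite ler_norml; apply/andP; split.
  by have := ler_norm2D u (v - u); rewrite addrC subrK norm2_distC; lra.
by have := ler_norm2D v (u - v); rewrite addrC subrK; lra.
Qed.

Lemma norm2_le_sum (R : realType) n (u : 'cV[R]_n) :
  norm2 u <= \sum_i `|u i 0|.
Proof.
have s0 : 0 <= \sum_i `|u i 0| by exact: sumr_ge0.
rewrite -(@ler_pXn2r _ 2) ?nnegrE ?norm2_ge0 // norm2_sqr expr2 mulr_suml.
apply: ler_sum => i _; rewrite -real_normK ?num_real // expr2 ler_wpM2l //.
by rewrite (bigD1 i) //= lerDl sumr_ge0.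
Qed.

Lemma coord_le_norm2 (R : realType) n (u : 'cV[R]_n) i : `|u i 0| <= norm2 u.
Proof.
rewrite -(@ler_pXn2r _ 2) ?nnegrE ?norm2_ge0 // norm2_sqr.
rewrite real_normK ?num_real // (bigD1 i) //= lerDl sumr_ge0 // => j _.
exact: sqr_ge0.
Qed.

Lemma norm2_mulmx_bounded (R : realType) m n (B : 'M[R]_(m, n)) :
  exists L : R, 0 < L /\ forall v, norm2 (B *m v) <= L * norm2 v.
Proof.
exists (1 + \sum_i \sum_j `|B i j|); split.
  by rewrite ltr_pwDl // sumr_ge0 // => i _; exact: sumr_ge0.
move=> v; rewrite (le_trans (norm2_le_sum _)) // mulrDl mul1r.
rewrite ler_wpDl ?norm2_ge0 //.
rewrite mulr_suml ler_sum // => i _; rewrite mxE mulr_suml.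
rewrite (le_trans (ler_norm_sum _ _ _)) // ler_sum // => j _.
by rewrite normrM ler_wpM2l ?coord_le_norm2.
Qed.

(** * Borel measurability of locally Lipschitz functions *)

(** The topology on matrices is that of the sup norm, so small coordinates have
to be turned into a small Euclidean norm. *)
Lemma near_norm2 (R : realType) n (x : 'cV[R]_n) (e : R) :
  0 < e -> \forall y \near x, norm2 (x - y) < e.
Proof.
move=> e0; have n0 : (0 : R) < n.+1%:R by [].
(* The sum of n coordinates below e / (n + 1) stays below e, also when n = 0. *)
apply/nbhs_ballP; exists (e / n.+1%:R); first by rewrite /= divr_gt0.
move=> y [_ xy]; apply: le_lt_trans (norm2_le_sum _) _.
apply: (@le_lt_trans _ _ (\sum_(i < n) e / n.+1%:R)).
  by apply: ler_sum => i _; rewrite !mxE; exact/ltW/xy.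
rewrite sumr_const card_ord -[ltLHS]mulr_natr -mulrA gtr_pMr //.
by rewrite ltr_pdivrMl // mulr1 ltr_nat.
Qed.

Lemma continuous_measurable_borelRn (R : realType) n (f : 'cV[R]_n -> R) :
  continuous f -> measurable_fun [set: borelRn R n] (f : borelRn R n -> R).
Proof.
move=> /continuousP cf; apply: (measurability _ (RGenOpens.measurableE R)).
move=> _ [_ [a [b ->] <-]]; rewrite setTI; apply: sub_sigma_algebra.
exact/cf/interval_open.
Qed.

Lemma locally_lipschitz_measurable (R : realType) n (f : 'cV[R]_n -> R) :
  (forall r : R, 0 < r -> exists K : R, 0 < K /\
     forall x y : 'cV[R]_n, Num.max (norm2 x) (norm2 y) < r ->
     `|f x - f y| <= K * norm2 (x - y)) ->
  measurable_fun [set: borelRn R n] (f : borelRn R n -> R).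
Proof.
move=> lf; apply: continuous_measurable_borelRn => x.
have r0 : 0 < norm2 x + 1 by rewrite ltr_wpDl ?norm2_ge0.
have [K [K0 fK]] := lf _ r0.
apply/(@cvgrPdist_lt _ _ _ _ (nbhs_filter x)) => e e0.
have m0 : 0 < Num.min 1 (e / K) by rewrite lt_min ltr01 divr_gt0.
apply: filterS (near_norm2 x m0) => y; rewrite lt_min => /andP[xy1 xye].
rewrite (le_lt_trans (fK x y _)) //; last by rewrite mulrC -ltr_pdivlMr.
rewrite gt_max ltrDl ltr01 /=.
by have := ler_norm2D x (y - x); rewrite addrC subrK norm2_distC; lra.
Qed.

(** * Two elementary estimates *)

(** The map a |-> exp (- a ^ 2 / 4) is Lipschitz because the Gaussian decay beats
the factor a in its derivative.  The proof avoids calculus.  For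
d = b - a >= 1 both values lie in [0, 1].  For d < 1 the values differ by at most
exp (- a ^ 2 / 4) times (b ^ 2 - a ^ 2) / 4 <= d (1 + a ^ 2 / 4), and the decay
absorbs the factor 1 + a ^ 2 / 4. *)
Lemma expR_gauss_lipschitz (R : realType) (a b : R) : 0 <= a -> 0 <= b ->
  `|expR (- (a ^+ 2 / 4)) - expR (- (b ^+ 2 / 4))| <= `|a - b|.
Proof.
wlog ab : a b / a <= b.
  move=> h a0 b0; have [ab|/ltW ba] := leP a b; first exact: h.
  by rewrite distrC [leRHS]distrC; exact: h.
move=> a0 b0; set d := b - a.
have d0 : 0 <= d by rewrite subr_ge0.
set u := a ^+ 2 / 4; set v := b ^+ 2 / 4.
have uv : u <= v by rewrite ler_pM2r // ler_pXn2r.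
rewrite ger0_norm; last by rewrite subr_ge0 ler_expR lerN2.
rewrite distrC ger0_norm // -/d.
have eu1 : expR (- u) <= 1 by rewrite expR_le1 oppr_le0 divr_ge0 ?sqr_ge0.
have ev0 := expR_gt0 (- v); have eu0 := expR_gt0 (- u).
have [d1|d1] := leP 1 d; first by lra.
have euv : expR (- u) * (1 - (v - u)) <= expR (- v).
  have -> : - v = - u + - (v - u) by ring.
  by rewrite expRD ler_pM2l // expR_ge1Dx.
have euu : expR (- u) * (1 + u) <= 1.
  by rewrite expRN ler_pdivrMl ?expR_gt0 // mulr1 expR_ge1Dx.
have vu : v - u <= d * (1 + u).
  have -> : v - u = d * ((a + b) / 4) by rewrite /v /u /d; field.
  apply: ler_wpM2l => //; rewrite /u; have := sqr_ge0 (a - 1).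
  by move: d1; rewrite /d; nra.
have : expR (- u) * (v - u) <= d.
  apply: le_trans (_ : expR (- u) * (d * (1 + u)) <= _).
    by rewrite ler_pM2l.
  by rewrite mulrCA -[leRHS]mulr1 ler_wpM2l.
by move: euv; rewrite mulrBr mulr1; lra.
Qed.

(** Lipschitz stability of the normalization of a root density.  With
s_i = 1 / sqrt l_i it splits s_1 g_1 - s_2 g_2 as
s_1 (g_1 - g_2) + (s_1 - s_2) g_2.  Since l_i <= 1, one has s_i >= 1, hence both
s_1 <= s_1 ^ 2 <= K and |s_1 - s_2| <= |s_1 ^ 2 - s_2 ^ 2| / 2, so that no
square root of K or of del appears. *)
Lemma normalized_lipschitz (R : realType) (l1 l2 g1 g2 del K : R) :
  0 < l1 <= 1 -> 0 < l2 <= 1 -> l1^-1 <= K -> l2^-1 <= K ->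
  0 <= g1 <= 1 -> 0 <= g2 <= 1 ->
  `|g1 - g2| <= del -> `|l1 - l2| <= 2 * del ->
  `|Num.sqrt l1^-1 * g1 - Num.sqrt l2^-1 * g2| <= K * (1 + K) * del.
Proof.
move=> /andP[l1_gt0 l1_le1] /andP[l2_gt0 l2_le1] l1K l2K.
move=> /andP[g1_ge0 g1_le1] /andP[g2_ge0 g2_le1] dg dl.
have del_ge0 : 0 <= del := le_trans (normr_ge0 _) dg.
have sqrtE (l : R) : 0 < l -> l * Num.sqrt l^-1 ^+ 2 = 1.
  by move=> l0; rewrite sqr_sqrtr ?invr_ge0 ?(ltW l0) // mulfV // lt0r_neq0.
have sqrt_ge1 (l : R) : 0 < l -> l <= 1 -> 1 <= Num.sqrt l^-1.
  move=> l0 l_le1; have : 1 <= l^-1 by rewrite invf_ge1.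
  by move=> /ler_wsqrtr; rewrite sqrtr1.
have sqrt2 (l : R) : 0 < l -> Num.sqrt l^-1 ^+ 2 = l^-1.
  by move=> l0; rewrite sqr_sqrtr // invr_ge0 ltW.
move: (sqrtE _ l1_gt0) (sqrtE _ l2_gt0) (sqrt_ge1 _ l1_gt0 l1_le1)
  (sqrt_ge1 _ l2_gt0 l2_le1) (sqrt2 _ l1_gt0) (sqrt2 _ l2_gt0).
set s1 := Num.sqrt l1^-1; set s2 := Num.sqrt l2^-1.
move=> ls1 ls2 s1_ge1 s2_ge1 s1E s2E.
have s1K : s1 ^+ 2 <= K by rewrite s1E.
have s2K : s2 ^+ 2 <= K by rewrite s2E.
have K_ge1 : 1 <= K by nra.
have s1_leK : s1 <= K by nra.
have ds : `|s1 - s2| <= K ^+ 2 * del.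
  have dsE : (s1 - s2) * (s1 + s2) = (l2 - l1) * (s1 ^+ 2 * s2 ^+ 2).
    transitivity ((l2 * s2 ^+ 2) * s1 ^+ 2 - (l1 * s1 ^+ 2) * s2 ^+ 2).
      by rewrite ls1 ls2; ring.
    by ring.
  have : `|s1 - s2| * (s1 + s2) <= 2 * del * K ^+ 2.
    have s12 : 0 <= s1 + s2 by lra.
    rewrite -[X in _ * X](ger0_norm s12) -normrM dsE normrM distrC.
    apply: ler_pM => //.
    rewrite ger0_norm ?(mulr_ge0 (sqr_ge0 _) (sqr_ge0 _)) // [leRHS]expr2.
    by apply: ler_pM => //; exact: sqr_ge0.
  have : `|s1 - s2| * 2 <= `|s1 - s2| * (s1 + s2).
    by apply: ler_wpM2l => //; lra.
  lra.
have -> : s1 * g1 - s2 * g2 = s1 * (g1 - g2) + (s1 - s2) * g2 by ring.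
apply: le_trans (ler_normD _ _) _; rewrite !normrM.
have -> : K * (1 + K) * del = K * del + K ^+ 2 * del * 1 by ring.
apply: lerD; apply: ler_pM => //; rewrite ger0_norm //; lra.
Qed.

(** * Posteriors of a general nonnegative potential *)

Lemma ae_probability_nonvoid (R : realType) d (T : measurableType d)
    (P : probability T R) : ~ {ae P, forall _ : T, False}.
Proof.
move=> [A [mA PA subA]].
have AT : A = setT by apply/seteqP; split=> // x _; exact: subA.
by move: PA; rewrite AT probability_setT => /eqP; rewrite onee_eq0.
Qed.

Lemma probability_of_density (R : realType) d (T : measurableType d)
    (P : probability T R) (f : T -> \bar R) :
  measurable_fun setT f -> (forall x, 0 <= f x)%E -> (\int[P]_x f x = 1)%E ->
  exists nu : probability T R,
    forall A, nu A = (\int[P]_(x in A) f x)%E.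
Proof.
move=> mf f0 f1; pose nu A := (\int[P]_(x in A) f x)%E.
have nu0 : nu set0 = 0%E by rewrite /nu integral_set0.
have nu_ge0 A : (0 <= nu A)%E by apply: integral_ge0.
have nuD : semi_sigma_additive nu by exact: semi_sigma_additive_nng_induced.
pose nuM : {measure set T -> \bar R} :=
  HB.pack nu (isMeasure.Build d T R nu nu0 nu_ge0 nuD).
(* nu already has mass one; normalizing it only supplies the structure of a
   probability. *)
exists (mnormalize nuM P) => A; have nuT : nuM setT = 1%E by exact: f1.
by rewrite /= /mnormalize nuT onee_eq0 /= invr1 mule1.
Qed.

Section posterior.
Local Open Scope charge_scope.
Variables (R : realType) (d : measure_display) (T : measurableType d).
Variable P : probability T R.
Implicit Types (Phi Psi : T -> R) (nu : probability T R).

Definition evidence Phi : R := fine (\int[P]_x (expR (- Phi x))%:E)%E.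

Lemma measurable_likelihood Phi (c : R) : measurable_fun setT Phi ->
  measurable_fun setT (fun x => (c * expR (- Phi x))%:E).
Proof.
move=> mPhi; apply/measurable_EFinP/measurable_funM => //.
by apply: measurableT_comp => //; exact: measurable_funN.
Qed.

Lemma likelihood_ge0 Phi (c : R) x : 0 <= c -> (0 <= (c * expR (- Phi x))%:E)%E.
Proof. by move=> c0; rewrite lee_fin mulr_ge0 ?expR_ge0. Qed.

Lemma measurable_expRN Phi : measurable_fun setT Phi ->
  measurable_fun setT (fun x => (expR (- Phi x))%:E).
Proof.
move=> mPhi; apply/measurable_EFinP/measurableT_comp => //.
exact: measurable_funN.
Qed.

(** Without absolute continuity the derivative is the constant -oo, which cannot
agree with a real number at any point. *)
Lemma posterior_dominated Phi nu : is_posterior P Phi nu -> nu `<< P.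
Proof.
move=> [c [_ dnu]]; apply: contrapT => nuP.
apply: (@ae_probability_nonvoid _ _ _ P).
by apply: filterS dnu => x; rewrite /Radon_Nikodym; case: pselect.
Qed.

Section evidence.
Variable Phi : T -> R.
Hypotheses (mPhi : measurable_fun setT Phi) (Phi_ge0 : forall x, 0 <= Phi x).

Let integral_expRN_le1 : (\int[P]_x (expR (- Phi x))%:E <= 1)%E.
Proof.
apply: (@le_trans _ _ (\int[P]_x (cst 1 x))%E).
  apply: ge0_le_integral => //.
  - exact: measurable_expRN.
  - by move=> x _; rewrite lee_fin expR_le1 oppr_le0.
by rewrite integral_cst // mul1e; exact: probability_le1.
Qed.

Lemma evidenceE : (\int[P]_x (expR (- Phi x))%:E)%E = (evidence Phi)%:E.
Proof.
rewrite /evidence fineK // ge0_fin_numE.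
  by rewrite (le_lt_trans integral_expRN_le1) // ltry.
by apply: integral_ge0 => x _; rewrite lee_fin expR_ge0.
Qed.

Lemma evidence_le1 : evidence Phi <= 1.
Proof. by rewrite -lee_fin -evidenceE. Qed.

(** A positive function with zero integral would vanish almost everywhere, which
is impossible on a space of mass one. *)
Lemma evidence_gt0 : 0 < evidence Phi.
Proof.
have ge0 : (0 <= \int[P]_x (expR (- Phi x))%:E)%E.
  by apply: integral_ge0 => x _; rewrite lee_fin expR_ge0.
rewrite lt_def -lee_fin -evidenceE ge0 andbT; apply/eqP => ev0.
have := evidenceE; rewrite ev0.
rewrite (_ : \int[P]_x _ = \int[P]_x `|(expR (- Phi x))%:E|)%E; last first.
  by apply: eq_integral => x _; rewrite gee0_abs // lee_fin expR_ge0.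
move/ae_eq_integral_abs => /(_ measurableT (measurable_expRN mPhi)) ae0.
apply: (@ae_probability_nonvoid _ _ _ P); apply: filterS ae0 => x /(_ I) [].
by have := expR_gt0 (- Phi x); move=> /[swap] ->; rewrite ltxx.
Qed.

Lemma integral_scaled_likelihood c : 0 <= c ->
  (\int[P]_x (c * expR (- Phi x))%:E = (c * evidence Phi)%:E)%E.
Proof.
move=> c0; under eq_integral do rewrite EFinM.
rewrite ge0_integralZl_EFin ?evidenceE ?EFinM //.
exact: measurable_expRN.
Qed.

(** Integrating the derivative over the whole space shows that the unspecified
normalization constant c satisfies 1 = c * evidence. *)
Lemma posterior_densityE nu : is_posterior P Phi nu ->
  {ae P, forall x, 'd (charge_of_finite_measure nu) '/d P x =
                   ((evidence Phi)^-1 * expR (- Phi x))%:E} /\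
  forall A, measurable A ->
    nu A = (\int[P]_(x in A) ((evidence Phi)^-1 * expR (- Phi x))%:E)%E.
Proof.
move=> post_nu; have nuP := posterior_dominated post_nu.
have [c [c0 dnu]] := post_nu.
have nuE A : measurable A ->
    nu A = (\int[P]_(x in A) (c * expR (- Phi x))%:E)%E.
  move=> mA; transitivity (charge_of_finite_measure nu A) => //.
  rewrite (Radon_Nikodym_integral (nu := charge_of_finite_measure nu) nuP mA).
  apply: ae_eq_integral => //.
  - apply: measurable_funTS; apply: measurable_int.
    exact: (Radon_Nikodym_integrable (nu := charge_of_finite_measure nu) nuP).
  - exact/measurable_funTS/measurable_likelihood.
  - by apply: filterS dnu => x ->.
suff -> : (evidence Phi)^-1 = c by [].
have := nuE _ measurableT.
rewrite probability_setT integral_scaled_likelihood ?(ltW c0) // => -[] h.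
have ev0 := lt0r_neq0 evidence_gt0.
by apply: (mulIf ev0); rewrite -h mulVf.
Qed.

Lemma is_posteriorP nu : is_posterior P Phi nu <->
  forall A, measurable A ->
    nu A = (\int[P]_(x in A) ((evidence Phi)^-1 * expR (- Phi x))%:E)%E.
Proof.
split=> [/posterior_densityE[]//|nuE]; have ev_gt0 := evidence_gt0.
have nuP : nu `<< P.
  apply/null_content_dominatesP => A mA PA0; rewrite nuE //.
  apply: null_set_integral => //.
  exact/measurable_funTS/measurable_likelihood.
exists (evidence Phi)^-1; split; first by rewrite invr_gt0.
have h : ae_eq P setT (fun x => ((evidence Phi)^-1 * expR (- Phi x))%:E)
    ('d (charge_of_finite_measure nu) '/d P).
  apply: integral_ae_eq => //.
  - apply/integrableP; split; first exact: measurable_likelihood.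
    under eq_integral do
      rewrite gee0_abs ?likelihood_ge0 ?invr_ge0 ?(ltW ev_gt0) //.
    by rewrite integral_scaled_likelihood ?invr_ge0 ?(ltW ev_gt0) // ltry.
  - by move=> A _ mA; rewrite -nuE //
      -(Radon_Nikodym_integral (nu := charge_of_finite_measure nu) nuP mA).
by apply: filterS h => x /(_ I) ->.
Qed.

Lemma posterior_exists : exists nu, is_posterior P Phi nu.
Proof.
have ev_gt0 := evidence_gt0.
have [||nu nuE] := @probability_of_density _ _ _ P
    (fun x => ((evidence Phi)^-1 * expR (- Phi x))%:E)
    (measurable_likelihood _ mPhi).
- by move=> x; rewrite likelihood_ge0 // invr_ge0 ltW.
- by rewrite integral_scaled_likelihood ?invr_ge0 ?ltW // mulVf // lt0r_neq0.
- by exists nu; apply/is_posteriorP => A _; exact: nuE.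
Qed.

End evidence.

Section comparison.
Variables Phi Psi : T -> R.
Hypotheses (mPhi : measurable_fun setT Phi) (Phi_ge0 : forall x, 0 <= Phi x).
Hypotheses (mPsi : measurable_fun setT Psi) (Psi_ge0 : forall x, 0 <= Psi x).

Lemma evidence_le_scale t : (forall x, Phi x <= Psi x + t) ->
  expR (- t) * evidence Psi <= evidence Phi.
Proof.
move=> le_t; rewrite -lee_fin -integral_scaled_likelihood ?expR_ge0 //.
rewrite -evidenceE //; apply: ge0_le_integral => //.
- exact: measurable_likelihood.
- exact: measurable_expRN.
- by move=> x _; rewrite lee_fin -expRD ler_expR; have := le_t x; lra.
Qed.

Lemma evidence_le_shift t : 0 <= t ->
  (forall x, expR (- Phi x) <= expR (- Psi x) + t) ->
  evidence Phi <= evidence Psi + t.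
Proof.
move=> t0 le_t; rewrite -lee_fin EFinD -!evidenceE //.
apply: (@le_trans _ _ (\int[P]_x ((expR (- Psi x))%:E + (cst t%:E x)))%E).
  apply: ge0_le_integral => //; first exact: measurable_expRN.
  - by apply: emeasurable_funD => //; exact: measurable_expRN.
  - by move=> x _; rewrite -EFinD lee_fin.
rewrite ge0_integralD //; last exact: measurable_expRN.
rewrite leeD2l // integral_cst // muleC gee_pMl ?fin_num_measure ?lee_fin //.
exact: probability_le1.
Qed.

End comparison.

Lemma evidence_dist_le Phi Psi (t : R) :
  measurable_fun setT Phi -> (forall x, 0 <= Phi x) ->
  measurable_fun setT Psi -> (forall x, 0 <= Psi x) ->
  (forall x, `|expR (- Phi x) - expR (- Psi x)| <= t) ->
  `|evidence Phi - evidence Psi| <= t.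
Proof.
move=> m1 p1 m2 p2 dexp.
have t0 : 0 <= t := le_trans (normr_ge0 _) (dexp point).
rewrite ler_distl lerBlDr; apply/andP; split; apply: evidence_le_shift => // x;
  have := dexp x; rewrite ler_distl => /andP[h1 h2] //.
by rewrite -lerBlDr.
Qed.

(** A bound on half-likelihoods uniform in x turns into a pointwise bound on the
root densities, and the integral of its square is controlled by the total mass
one of P. *)
Lemma hellinger_posterior_le Phi1 Phi2 nu1 nu2 (del K : R) :
  measurable_fun setT Phi1 -> (forall x, 0 <= Phi1 x) ->
  measurable_fun setT Phi2 -> (forall x, 0 <= Phi2 x) ->
  is_posterior P Phi1 nu1 -> is_posterior P Phi2 nu2 ->
  (evidence Phi1)^-1 <= K -> (evidence Phi2)^-1 <= K ->
  (forall x, `|expR (- (Phi1 x / 2)) - expR (- (Phi2 x / 2))| <= del) ->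
  (hellinger P nu1 nu2 <= (K * (1 + K) * del)%:E)%E.
Proof.
move=> m1 p1 m2 p2 post1 post2 K1 K2 dg.
have sqr_half Phi x : expR (- Phi x) = expR (- (Phi x / 2)) ^+ 2.
  by rewrite expr2 -expRD; congr expR; field.
have half01 Phi x : (forall x, 0 <= Phi x) -> 0 <= expR (- (Phi x / 2)) <= 1.
  by move=> Phi_ge0; rewrite expR_ge0 expR_le1 oppr_le0 divr_ge0.
have sqrt_density Phi x : 0 < evidence Phi ->
    Num.sqrt ((evidence Phi)^-1 * expR (- Phi x)) =
    Num.sqrt (evidence Phi)^-1 * expR (- (Phi x / 2)).
  move=> ev0; rewrite sqrtrM ?invr_ge0 ?(ltW ev0) //.
  by rewrite sqr_half sqrtr_sqr ger0_norm // expR_ge0.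
have e1 := evidence_gt0 m1 p1; have e2 := evidence_gt0 m2 p2.
have e1' := evidence_le1 m1 p1; have e2' := evidence_le1 m2 p2.
have del_ge0 : 0 <= del by apply: le_trans (dg point).
have dev : `|evidence Phi1 - evidence Phi2| <= 2 * del.
  apply: evidence_dist_le => // x; rewrite !sqr_half subr_sqr normrM mulrC.
  have /andP[a0 a1] := half01 Phi1 x p1; have /andP[b0 b1] := half01 Phi2 x p2.
  by apply: ler_pM => //; rewrite ger0_norm ?addr_ge0 // (lerD a1 b1).
have B_ge0 : 0 <= K * (1 + K) * del.
  have K_ge0 : 0 <= K by apply: le_trans K1; rewrite invr_ge0 ltW.
  by rewrite !mulr_ge0 // addr_ge0.
set B := K * (1 + K) * del in B_ge0 *.
have [d1 _] := posterior_densityE m1 p1 post1.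
have [d2 _] := posterior_densityE m2 p2 post2.
rewrite /hellinger.
set F := (X in integral _ _ X).
(* The factor 1/2 is simply dropped. *)
suff intF : (\int[P]_x F x <= (B ^+ 2)%:E)%E.
  have -> : (B%:E = sqrte (B ^+ 2)%:E)%E by rewrite /= sqrtr_sqr ger0_norm.
  rewrite lee_sqrt ?lee_fin ?sqr_ge0 //.
  have F_ge0 : (0 <= \int[P]_x F x)%E.
    by apply: integral_ge0 => x _; rewrite lee_fin sqr_ge0.
  apply: le_trans intF; rewrite gee_pMl //.
  by rewrite lee_fin invf_le1 // ler1n.
apply: (@le_trans _ _ (\int[P]_x (cst (B ^+ 2)%:E x))%E); last first.
  rewrite integral_cst // muleC gee_pMl ?fin_num_measure ?lee_fin ?sqr_ge0 //.
  exact: probability_le1.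
apply: ae_ge0_le_integral => //.
- by move=> x _; rewrite lee_fin sqr_ge0.
- have mF nu : is_posterior P Phi1 nu \/ is_posterior P Phi2 nu ->
      measurable_fun setT (fun x =>
        Num.sqrt (fine ('d (charge_of_finite_measure nu) '/d P x))).
    move=> post; apply: measurableT_comp.
      exact: continuous_measurable_fun (@sqrt_continuous R).
    apply: measurableT_comp; first exact: fine_measurable.
    apply: measurable_int.
    apply: (Radon_Nikodym_integrable (nu := charge_of_finite_measure nu)).
    by case: post => /posterior_dominated.
  apply/measurable_EFinP/measurable_funX/measurable_funB.
    by apply: mF; left.
  by apply: mF; right.
- by move=> x _; rewrite lee_fin sqr_ge0.
- apply: filterS2 d1 d2 => x d1 d2 _; rewrite /F d1 d2 /= lee_fin.
  rewrite !sqrt_density // -real_normK ?num_real // ler_pXn2r ?nnegrE //.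
  apply: normalized_lipschitz => //; rewrite ?e1 ?e2 ?half01 //; exact: dg.
Qed.

End posterior.
(** * The Gaussian misfit *)

Lemma cov_norm_ge0 (R : realType) n (S : 'M[R]_n) v : 0 <= cov_norm S v.
Proof. exact: norm2_ge0. Qed.

Lemma ler_cov_normD (R : realType) n (S : 'M[R]_n) u v :
  cov_norm S (u + v) <= cov_norm S u + cov_norm S v.
Proof. by rewrite /cov_norm mulmxDr ler_norm2D. Qed.

Lemma cov_normN (R : realType) n (S : 'M[R]_n) v :
  cov_norm S (- v) = cov_norm S v.
Proof. by rewrite /cov_norm mulmxN norm2N. Qed.

Lemma ler_dist_cov_norm (R : realType) n (S : 'M[R]_n) u v :
  `|cov_norm S u - cov_norm S v| <= cov_norm S (u - v).
Proof. by rewrite /cov_norm mulmxBr ler_dist_norm2. Qed.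

Lemma misfit_ge0 (R : realType) N M (S : 'M[R]_M)
    (G : 'cV[R]_N -> 'cV[R]_M) Y Z :
  0 <= misfit S G Y Z.
Proof. by rewrite mulr_ge0 ?invr_ge0 ?sqr_ge0. Qed.

Lemma measurable_misfit (R : realType) N M (S : 'M[R]_M)
    (G : 'cV[R]_N -> 'cV[R]_M) (Y : 'cV[R]_M) :
  (forall r : R, 0 < r -> exists K : R, 0 < K /\
     forall Z1 Z2 : 'cV[R]_N, Num.max (norm2 Z1) (norm2 Z2) < r ->
     cov_norm S (G Z1 - G Z2) <= K * norm2 (Z1 - Z2)) ->
  measurable_fun [set: borelRn R N] (misfit S G Y : borelRn R N -> R).
Proof.
move=> lipG; apply: measurable_funM => //; apply: measurable_funX.
apply: (@locally_lipschitz_measurable R N (fun Z => cov_norm S (Y - G Z))).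
move=> r /lipG[K [K0 GK]]; exists K; split=> // x y /GK; apply: le_trans.
rewrite (le_trans (ler_dist_cov_norm _ _ _)) // -cov_normN.
by rewrite [in X in - (_ + X)]opprD addrACA subrr add0r opprK opprD opprK.
Qed.

(** Splits the dependence on the data from that on the parameter:
(y + g) ^ 2 <= 2 y ^ 2 + 2 g ^ 2, and 2 * misfit S G 0 Z is |G Z|_S ^ 2. *)
Lemma misfit_le (R : realType) N M (S : 'M[R]_M)
    (G : 'cV[R]_N -> 'cV[R]_M) Y Z :
  misfit S G Y Z <= 2 * misfit S G 0 Z + cov_norm S Y ^+ 2.
Proof.
have := ler_cov_normD S Y (- G Z); rewrite cov_normN.
rewrite /misfit sub0r cov_normN.
have := cov_norm_ge0 S (Y - G Z); have := cov_norm_ge0 S Y.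
have := cov_norm_ge0 S (G Z).
move: (cov_norm S (Y - G Z)) (cov_norm S Y) (cov_norm S (G Z)).
move=> a y g g0 y0 a0 h.
have : a ^+ 2 <= (y + g) ^+ 2 by rewrite ler_pXn2r ?nnegrE ?addr_ge0.
have := sqr_ge0 (y - g); nra.
Qed.

Theorem theorem2p2 (R : realType) (N M : nat)
    (k : R) (hk : 0 < k)
    (d0 dl : 'cV[R]_2) (hd0 : norm2 d0 = 1) (hdl : norm2 dl = 1)
    (xhat : 'I_M -> 'cV[R]_2) (hxhat : forall m, norm2 (xhat m) = 1)
    (D : 'cV[R]_N -> set 'cV[R]_2)
    (hD : forall Z, obstacle (D Z) \/ crack (D Z))
    (G : 'cV[R]_N -> 'cV[R]_M)
    (hG : phaseless_far_field_map k d0 dl xhat D G)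
    (Sigma : 'M[R]_M) (hSigma : posdefmx Sigma)
    (hi : forall eps : R, 0 < eps -> exists Mhat : R, forall Z : 'cV[R]_N,
       cov_norm Sigma (G Z) <= expR (eps * norm2 Z ^+ 2 + Mhat))
    (hii : forall r : R, 0 < r -> exists K : R, 0 < K /\
       forall Z1 Z2 : 'cV[R]_N, Num.max (norm2 Z1) (norm2 Z2) < r ->
       cov_norm Sigma (G Z1 - G Z2) <= K * norm2 (Z1 - Z2))
    (mu_pr : probability (borelRn R N) R) :
  (forall Y : 'cV[R]_M, exists mu_post : probability (borelRn R N) R,
     [/\ is_posterior mu_pr (misfit Sigma G Y) mu_post,
         (forall nu : probability (borelRn R N) R,
            is_posterior mu_pr (misfit Sigma G Y) nu ->
            forall A, measurable A -> nu A = mu_post A) &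
         mu_post `<< mu_pr]) /\
  (forall r : R, 0 < r -> exists C : R, 0 < C /\
     forall Y1 Y2 : 'cV[R]_M, Num.max (norm2 Y1) (norm2 Y2) < r ->
     forall mu1 mu2 : probability (borelRn R N) R,
       is_posterior mu_pr (misfit Sigma G Y1) mu1 ->
       is_posterior mu_pr (misfit Sigma G Y2) mu2 ->
       (hellinger mu_pr mu1 mu2 <= (C * norm2 (Y1 - Y2))%:E)%E).
Proof.
have mPhi Y := measurable_misfit Y hii.
have Phi_ge0 Y := misfit_ge0 Sigma G Y.
split=> [Y|r r0].
  have [nu post_nu] := posterior_exists mu_pr (mPhi Y) (Phi_ge0 Y).
  exists nu; split=> //; last exact: posterior_dominated post_nu.
  move=> nu' post_nu' A mA.
  have [_ ->//] := posterior_densityE (mPhi Y) (Phi_ge0 Y) post_nu'.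
  by have [_ ->] := posterior_densityE (mPhi Y) (Phi_ge0 Y) post_nu.
have [L [L0 SL]] := norm2_mulmx_bounded (inv_sqrtmx Sigma).
(* Psi dominates every potential with |Y| < r up to the constant (L r) ^ 2. *)
pose Psi Z := 2 * misfit Sigma G 0 Z.
have mPsi : measurable_fun [set: borelRn R N] (Psi : borelRn R N -> R).
  exact: measurable_funM.
have Psi_ge0 Z : 0 <= Psi Z by rewrite mulr_ge0.
have evPsi := evidence_gt0 mu_pr mPsi Psi_ge0.
pose K := (expR (- (L * r) ^+ 2) * evidence mu_pr Psi)^-1.
have K0 : 0 < K by rewrite invr_gt0 mulr_gt0 ?expR_gt0.
have evK Y : norm2 Y < r -> (evidence mu_pr (misfit Sigma G Y))^-1 <= K.
  move=> Yr; rewrite lef_pV2 ?posrE ?mulr_gt0 ?expR_gt0 ?evidence_gt0 //.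
  apply: evidence_le_scale => // Z; apply: le_trans (misfit_le _ _ _ _) _.
  rewrite lerD2l ler_pXn2r ?nnegrE ?cov_norm_ge0 ?mulr_ge0 ?ltW //.
  by apply: le_lt_trans (SL Y) _; rewrite ltr_pM2l.
exists (K * (1 + K) * L); split; first by rewrite !mulr_gt0 // addr_gt0.
move=> Y1 Y2; rewrite gt_max => /andP[Y1r Y2r] mu1 mu2 post1 post2.
rewrite -[K * (1 + K) * L * _]mulrA.
apply: (hellinger_posterior_le (mPhi Y1) (Phi_ge0 Y1) (mPhi Y2) (Phi_ge0 Y2)
  post1 post2 (evK _ Y1r) (evK _ Y2r)) => Z.
have half Y : misfit Sigma G Y Z / 2 = cov_norm Sigma (Y - G Z) ^+ 2 / 4.
  by rewrite /misfit; field.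
rewrite !half.
apply: le_trans (expR_gauss_lipschitz _ _) _; rewrite ?cov_norm_ge0 //.
apply: le_trans (ler_dist_cov_norm _ _ _) _.
by rewrite opprB addrA subrK; exact: SL.
Qed.
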